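(* Let $\mathbb{K}$ be a cyclic number field of degree $n$, let $\theta$ be a generator of $G=\operatorname{Gal}(\mathbb{K}/\mathbb{Q})$, and let $\sigma=(\sigma_1,\dots,\sigma_n)$ be the Minkowski embedding with $\sigma_k=\theta^{n-k+1}$ for $1\le k\le n$. Let $\mathcal{I}$ be a nonzero (fractional or integral) ideal in $\mathbb{K}$. Then the lattice $\Lambda=\sigma(\mathcal{I})$ is cyclic if and only if, for all nonzero prime ideals $\mathcal{P},\mathcal{Q}$ of $\mathcal{O}_{\mathbb{K}}$, $$\mathcal{P}\text{ and }\mathcal{Q}\text{ are conjugate}\ \Longrightarrow\ \nu_{\mathcal{I}}(\mathcal{P})=\nu_{\mathcal{I}}(\mathcal{Q}).$$
   Context: A cyclic number field is a number field $\mathbb{K}$ such that $\mathbb{K}/\mathbb{Q}$ is Galois with cyclic Galois group; $\mathcal{O}_{\mathbb{K}}$ is its ring of integers. $\mathbb{K}$ is regarded as a subfield of $\mathbb{C}$ and its embeddings into $\mathbb{C}$ are identified with the elements of $G$. The Minkowski embedding is $\sigma:\mathbb{K}\to\mathbb{C}^n$, $\sigma(x)=(\sigma_1(x),\dots,\sigma_n(x))$. The shift operator is $\rho(c_1,\dots,c_n)=(c_n,c_1,\dots,c_{n-1})$ on $\mathbb{C}^n$, and $\Lambda$ is cyclic if $\rho(\Lambda)=\Lambda$. Two prime ideals $\mathcal{P},\mathcal{Q}$ of $\mathcal{O}_{\mathbb{K}}$ are conjugate if there exists $\tau\in G$ with $\tau(\mathcal{P})=\mathcal{Q}$. $\nu_{\mathcal{I}}(\mathcal{P})\in\mathbb{Z}$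 denotes the exponent of $\mathcal{P}$ in the prime ideal factorization of $\mathcal{I}$ (it is $0$ if $\mathcal{P}$ does not occur). *)

(* Defs.v *)
(* World: MathComp, with the classical sets of MathComp-Analysis. *)
From mathcomp Require Export all_boot all_order all_algebra.
From mathcomp Require Export all_fingroup all_solvable all_field.
From mathcomp Require Export boolp classical_sets reals complex.

Set Implicit Arguments.
Unset Strict Implicit.
Unset Printing Implicit Defensive.

Import GRing.Theory.
Local Open Scope classical_set_scope.
Local Open Scope ring_scope.

(* A number field is a finite extension K of rat; the prime field is 1%VS.
   No generality is lost in taking K in splittingFieldType rat, where the library
   defines 'Gal({:K} / 1): a Galois extension is a splitting field. *)
Definition cyclic_number_field (K : splittingFieldType rat) : Prop :=
  galois 1%VS {:K}%VS /\ cyclic 'Gal({:K} / 1).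

Section Ideals.
Variable K : fieldExtType rat.
Implicit Types (A B I P : set K).

Definition ring_of_integers : set K :=
  [set x | integralOver (intr : int -> K) x].
Local Notation OK := ring_of_integers.

Definition OK_submodule A : Prop :=
  [/\ A 0,
      forall x y, A x -> A y -> A (x + y)
    & forall a x, OK a -> A x -> A (a * x)].

(* Integral ideals are the case d = 1; the zero ideal is allowed here. *)
Definition fractional_ideal I : Prop :=
  OK_submodule I /\
  exists d : K, [/\ OK d, d != 0 & forall x, I x -> OK (d * x)].

Definition prime_ideal P : Prop :=
  [/\ OK_submodule P, P `<=` OK, ~ P 1
    & forall x y, OK x -> OK y -> P (x * y) -> P x \/ P y].

Definition nonzero_ideal I : Prop := exists2 x, I x & x != 0.

Definition ideal_mul A B : set K :=
  [set x | exists s : seq (K * K),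
     (forall p, p \in s -> A p.1 /\ B p.2) /\ x = \sum_(p <- s) p.1 * p.2].

Definition ideal_inv A : set K := [set x | forall a, A a -> OK (x * a)].

Definition ideal_exp A (m : int) : set K :=
  match m with
  | Posz k => iter k (ideal_mul A) OK
  | Negz k => iter k.+1 (ideal_mul (ideal_inv A)) OK
  end.

(* The second clause makes e zero outside a finite set of nonzero primes,
   so that such an e is determined on all of set K. *)
Definition prime_factorization I (e : set K -> int) : Prop :=
  exists s : seq (set K),
    [/\ uniq s,
        forall P, P \in s -> prime_ideal P /\ nonzero_ideal P,
        forall P, P \notin s -> e P = 0
      & I = \big[ideal_mul/OK]_(P <- s) ideal_exp P (e P)].

(* The default value is used only if I has no prime ideal factorization, which
   does not occur for a nonzero fractional ideal. *)
Definition ideal_valuation I : set K -> int :=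
  xget (fun=> 0) [set e | prime_factorization I e].

End Ideals.

Definition conjugate_ideals (K : splittingFieldType rat) (P Q : set K) : Prop :=
  exists2 tau : gal_of {:K}, tau \in 'Gal({:K} / 1)%g &
    [set tau x | x in P] = Q.

(* (c_1, ..., c_n) |-> (c_n, c_1, ..., c_(n-1)); ord_pred is cyclic. *)
Definition shift (T : Type) (n : nat) (c : 'rV[T]_n) : 'rV[T]_n :=
  \row_(j < n) c ord0 (ord_pred j).

Definition cyclic_lattice (T : Type) (n : nat) (L : set 'rV[T]_n) : Prop :=
  [set shift c | c in L] = L.

(* iota is the inclusion of K in the complex numbers. Coordinates are numbered
   from 0, so coordinate j is sigma_(j+1) = theta^(n-j). *)
Definition minkowski (R : realType) (K : splittingFieldType rat)
    (iota : {rmorphism K -> R[i]}) (n : nat) (theta : gal_of {:K}) (x : K) :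
    'rV[R[i]]_n :=
  \row_(j < n) iota ((theta ^+ (n - j))%g x).

(* Main.v *)
(* Since theta has order n, the shift of sigma(x) is sigma(theta x), and sigma is
   injective, so the lattice is cyclic exactly when theta(I) = I. Applying theta to
   I = prod P^(e P) gives theta(I) = prod P^(e (theta^-1 P)); as the exponents of the
   factorization are unique and determine the ideal, theta(I) = I exactly when e is
   constant on the orbits of the Galois group.

   Existence and uniqueness of the factorization rest on one finiteness fact: the
   residues modulo a nonzero element form a finite set, because the trace form
   embeds the ring of integers in Z^n. Hence ideals containing a fixed nonzero
   element satisfy the ascending chain condition, and the powers of an integer repeat
   modulo that element, which yields that nonzero primes are maximal, that
   multipliers of an ideal are integral, and that primes are invertible. *)
From HB Require Import structures.
From mathcomp Require Import zify ring.
Require Import Defs.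

Set Implicit Arguments.
Unset Strict Implicit.
Unset Printing Implicit Defensive.

Import Order.TTheory GRing.Theory Num.Theory.
Local Open Scope classical_set_scope.
Local Open Scope ring_scope.

(** * The ring of integers *)

Section RingOfIntegers.
Variable K : fieldExtType rat.
Local Notation OK := (@ring_of_integers K).

Lemma OK_int (m : int) : OK (m%:~R).
Proof. exact: (integral_id (intr : {rmorphism int -> K})). Qed.

Lemma OK0 : OK 0. Proof. exact: (OK_int 0). Qed.
Lemma OK1 : OK 1. Proof. exact: (OK_int 1). Qed.

Lemma OKD x y : OK x -> OK y -> OK (x + y).
Proof. exact: (@integral_add _ _ (intr : {rmorphism int -> K})). Qed.

Lemma OKM x y : OK x -> OK y -> OK (x * y).
Proof. exact: (@integral_mul _ _ (intr : {rmorphism int -> K})). Qed.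

Lemma OKN x : OK x -> OK (- x).
Proof. exact: (@integral_opp _ _ (intr : {rmorphism int -> K})). Qed.

Lemma OKX x n : OK x -> OK (x ^+ n).
Proof. by move=> Ox; elim: n => [|n IH]; rewrite ?exprS; [exact: OK1|exact: OKM]. Qed.

Lemma OK_monic_root (p : {poly K}) x :
  p \is monic -> root p x -> (forall i, OK p`_i) -> OK x.
Proof.
move=> pm px pO; apply: (@integral_root_monic _ _ (intr : {rmorphism int -> K})) pm px _.
exact/(integral_poly (intr : {rmorphism int -> K})).
Qed.

Lemma intr_eq0_numfield (m : int) : (m%:~R == 0 :> K) = (m == 0).
Proof. by rewrite -(rmorph_int (in_alg K)) fmorph_eq0 intr_eq0. Qed.

Lemma map_poly_intr_in_alg (p : {poly int}) :
  map_poly intr p = map_poly (in_alg K) (map_poly intr p).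
Proof.
rewrite -map_poly_comp; apply: eq_map_poly => m.
by rewrite -[RHS]/(in_alg K m%:~R) rmorph_int.
Qed.

Lemma OK_rat (q : rat) : OK q%:A -> q \in Num.int.
Proof.
case=> p pm.
rewrite map_poly_intr_in_alg -[q%:A]/(in_alg K q) fmorph_root => pq.
have: (ratr q : algC) \in Num.int.
  apply: Cint_rat_Aint; first exact: Crat_rat.
  apply: (@root_monic_Aint (map_poly ratr (map_poly intr p))).
  - by rewrite fmorph_root.
  - by rewrite map_monic; exact: monic_map.
  - by apply/polyOverP => i; rewrite !coef_map /= ratr_int intr_int.
by move=> /intrP[m]; rewrite -[m%:~R]ratr_int => /fmorph_inj ->; apply: intr_int.
Qed.

Lemma OK_denominator (x : K) : exists2 c : int, c != 0 & OK (c%:~R * x).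
Proof.
have [p p0 px] : exists2 p : {poly int}, p != 0 & root (map_poly intr p) x.
  have /integral_algebraic[r r0 rx] : integralOver (in_alg K) x.
    have /polyOver1P[r rE] := minPolyOver 1 x.
    exists r; last by rewrite -rE root_minPoly.
    by rewrite -(map_monic (in_alg K)) -rE monic_minPoly.
  have [q [a a0 rE]] := rat_poly_scale r.
  exists q; first by apply: contraNneq r0 => q0; rewrite rE q0 map_poly0 scaler0.
  move: rx; rewrite map_poly_intr_in_alg rE linearZ /= rootZ //.
  by rewrite scaler_eq0 invr_eq0 intr_eq0 oner_eq0 orbF.
have c0 : lead_coef p != 0 by rewrite lead_coef_eq0.
exists (lead_coef p) => //.
have [n pn] : exists n, size p = n.+2.
  case E: (size p) => [|[|n]]; [| |by exists n].
    by move/eqP: E p0; rewrite size_poly_eq0 => ->.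
  move: E px => /eqP /size_poly1P [k k0 ->].
  by rewrite map_polyC rootC intr_eq0_numfield (negPf k0).
pose c : K := (lead_coef p)%:~R.
(* Q is c^n p(X/c), monic because p has degree n + 1 and leading coefficient c. *)
pose Q : {poly K} :=
  \poly_(i < n.+2) (if i == n.+1 then 1 else (p`_i)%:~R * c ^+ (n - i)).
have Qlead : Q`_n.+1 = 1 by rewrite coef_poly leqnn eqxx.
have Qsize : size Q = n.+2 by rewrite size_poly_eq // eqxx oner_eq0.
apply: (@OK_monic_root Q).
- by rewrite monicE lead_coefE Qsize Qlead.
- suff QE : Q.[c * x] = c ^+ n * (map_poly intr p).[x].
    by rewrite /root QE (rootP px) mulr0.
  rewrite horner_poly.
  rewrite horner_coef size_map_poly_id0 ?intr_eq0_numfield ?lead_coef_eq0 //.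
  rewrite pn mulr_sumr; apply: eq_bigr => i _; rewrite coef_map /= exprMn.
  case: eqP => [->|/eqP ni].
    by rewrite mul1r exprSr /c lead_coefE pn /= !mulrA.
  have ile : (i <= n)%N by rewrite -ltnS ltn_neqAle ni -ltnS ltn_ord.
  have -> : c ^+ n = c ^+ (n - i) * c ^+ i by rewrite -exprD subnK.
  by rewrite -!mulrA mulrCA; congr (_ * _); rewrite mulrCA.
- move=> i; rewrite coef_poly; case: ifP => _; last exact: OK0.
  case: ifP => _; first exact: OK1.
  by apply: OKM; [exact: OK_int|apply: OKX; exact: OK_int].
Qed.

Lemma OK_common_denominator (s : seq K) :
  exists2 c : nat, (0 < c)%N & forall x, x \in s -> OK (c%:R * x).
Proof.
elim: s => [|x s [c c0 cs]]; first by exists 1%N.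
have [d d0 dx] := OK_denominator x.
exists (c * absz d)%N; first by rewrite muln_gt0 c0 absz_gt0.
have OKd : OK ((absz d)%:R) by exact: (OK_int (absz d)).
have OKc : OK (c%:R) by exact: (OK_int c).
have OKdx : OK ((absz d)%:R * x).
  rewrite -[(absz d)%:R]/((absz d)%:~R) abszE.
  case: (ger0P d) => // _; rewrite rmorphN mulNr; exact: OKN.
move=> y; rewrite inE natrM => /predU1P[->|ys]; first by rewrite -mulrA; exact: OKM.
by rewrite mulrAC; apply: OKM => //; exact: cs.
Qed.

End RingOfIntegers.

(** * Finiteness of residues *)

Lemma OK_rmorph (K L : fieldExtType rat) (f : {rmorphism K -> L}) x :
  @ring_of_integers K x -> @ring_of_integers L (f x).
Proof.
case=> p pm px; exists p => //.
rewrite -(fmorph_root f) -map_poly_comp in px.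
by rewrite -(eq_map_poly (rmorph_int f)).
Qed.

Section FiniteResidues.
Variable K : splittingFieldType rat.
Hypothesis K_galois : galois 1%VS {:K}%VS.
Local Notation OK := (@ring_of_integers K).
Local Notation tr := (galTrace 1 {:K}).

Lemma galTraceZ (q : rat) x : tr (q *: x) = q *: tr x.
Proof. by rewrite /galTrace scaler_sumr; apply: eq_bigr => g _; rewrite linearZ. Qed.

Lemma galTrace1_neq0 : tr 1 != 0.
Proof.
rewrite /galTrace (eq_bigr (fun=> 1)) => [|g _]; last exact: rmorph1.
rewrite sumr_const -[_ *+ _]/(#|_|%:~R) intr_eq0_numfield.
by rewrite -lt0n; exact: cardG_gt0.
Qed.

Lemma trace_rat : exists t : K -> rat,
  [/\ forall x, tr x = (t x)%:A, {morph t : x y / x + y}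
    & forall (q : rat) x, t (q *: x) = q * t x].
Proof.
have /choice[t tE] x : exists q : rat, tr x = q%:A.
  by apply/vlineP/mem_galTrace; rewrite ?memvf.
exists t; split=> // [x y|q x]; apply: (fmorph_inj (in_alg K)).
- by rewrite rmorphD /= -!tE raddfD.
- by rewrite rmorphM /= -!tE galTraceZ tE mulr_algl.
Qed.

Lemma OK_trace x : OK x -> OK (tr x).
Proof.
move=> Ox; rewrite /galTrace; elim/big_ind: _ => [|u v|g _].
- exact: OK0.
- exact: OKD.
- exact: OK_rmorph.
Qed.

Lemma OK_dual_basis : exists d, exists b b' : 'I_d -> K, exists t : K -> rat,
  [/\ forall i, OK (b i),
      forall x y, t (x - y) = t x - t y,
      forall x, OK x -> t x \in Num.int
    & forall x, x = \sum_i t (x * b i) *: b' i].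
Proof.
have [t [trE tD tZ]] := trace_rat.
have t0 : t 0 = 0 by rewrite -(scale0r 0) tZ mul0r.
have tsum_rat := big_morph t tD t0.
pose d := \dim {:K}.
have [c c0 cb] := OK_common_denominator (vbasis {:K}).
have cK0 : c%:R != 0 :> rat by rewrite pnatr_eq0 -lt0n.
pose b (i : 'I_d) : K := c%:R * (vbasis {:K})`_i.
have bE i : b i = (c%:R : rat) *: (vbasis {:K})`_i by rewrite scaler_nat -mulr_natl.
pose u x : 'rV[rat]_d := \row_i (c%:R^-1 * coord (vbasis {:K}) i x).
have uE x : x = \sum_i u x 0 i *: b i.
  rewrite {1}(coord_vbasis (memvf x)); apply: eq_bigr => i _.
  by rewrite bE mxE scalerA mulrAC mulVf // mul1r.
pose G : 'M[rat]_d := \matrix_(j, i) t (b j * b i).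
have tmx (v : 'rV[rat]_d) i : t ((\sum_j v 0 j *: b j) * b i) = (v *m G) 0 i.
  rewrite mxE mulr_suml tsum_rat; apply: eq_bigr => j _.
  by rewrite -scalerAl tZ mxE.
have Gu : G \in unitmx.
  rewrite -row_free_unit; apply/inj_row_free => v vG0.
  pose x := \sum_j v 0 j *: b j.
  have tx0 y : t (x * y) = 0.
    rewrite (uE y) mulr_sumr tsum_rat big1 // => i _.
    by rewrite -scalerAr tZ tmx vG0 [X in _ * X]mxE mulr0.
  have x0 : x = 0.
    apply/eqP; apply: contraT => xn0.
    by have := galTrace1_neq0; rewrite trE -(divff xn0) tx0 scale0r eqxx.
  apply/rowP => i; rewrite mxE.
  have : \sum_j (c%:R * v 0 j) *: (vbasis {:K})`_j = 0.
    rewrite -[RHS]x0; apply: eq_bigr => j _.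
    by rewrite bE scalerA mulrC.
  have /freeP/(_ _) := basis_free (vbasisP {:K}) => /[apply] /(_ i) /eqP.
  by rewrite mulf_eq0 (negPf cK0) => /eqP.
exists d, b, (fun i => \sum_j invmx G i j *: b j), t; split.
- by move=> i; apply: cb; apply: mem_nth; rewrite size_tuple.
- by move=> x y; rewrite tD -[- y]scaleN1r tZ mulN1r.
- by move=> x /OK_trace; rewrite trE; exact: OK_rat.
- move=> x.
  have uG : u x *m G = \row_i t (x * b i).
    by apply/rowP => i; rewrite -tmx -uE mxE.
  rewrite {1}(uE x) -[u x](mulmxK Gu) uG.
  under eq_bigr => j _ do rewrite mxE scaler_suml.
  rewrite exchange_big /=; apply: eq_bigr => i _.
  by rewrite scaler_sumr; apply: eq_bigr => j _; rewrite mxE scalerA.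
Qed.

Lemma finite_residues (a : K) : a != 0 ->
  exists (T : finType) (f : K -> T), forall x y, OK x -> OK y -> f x = f y ->
    exists2 c, OK c & x - y = a * c.
Proof.
move=> a0; have [d [b [b' [t [Ob tB tint tE]]]]] := OK_dual_basis.
have [[//|M] _ MO] := OK_common_denominator [seq a^-1 * b' i | i : 'I_d].
pose z x i : int := Num.floor (t (x * b i)).
have zE x i : OK x -> t (x * b i) = (z x i)%:~R.
  by move=> Ox; apply/esym/eqP; rewrite -intrEfloor; apply: tint; apply: OKM.
exists {ffun 'I_d -> 'I_M.+1}, (fun x => [ffun i => inord `|(z x i %% M.+1%:Z)%Z|%N]).
move=> x y Ox Oy fxy.
have zxy i : (z x i = z y i %[mod M.+1%:Z])%Z.
  move/ffunP/(_ i): fxy; rewrite !ffunE => /(congr1 val).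
  have lt u : (`|(u %% M.+1%:Z)%Z| < M.+1)%N.
    by rewrite -ltz_nat gez0_abs ?modz_ge0 // ltz_pmod.
  rewrite /= !inordK ?lt // => /(congr1 Posz).
  by rewrite !gez0_abs ?modz_ge0.
have {zxy} zxy i : exists k : int, z x i - z y i = k * M.+1%:Z.
  by apply/dvdzP; rewrite -eqz_mod_dvd; apply/eqP.
have [k kE] := choice zxy.
exists (\sum_i (k i)%:~R * (M.+1%:R * (a^-1 * b' i))).
  elim/big_ind: _ => [|u v|i _]; [exact: OK0|exact: OKD|].
  by apply: OKM; [exact: OK_int|apply: MO; apply: map_f; rewrite mem_enum].
rewrite {1}(tE (x - y)) mulr_sumr; apply: eq_bigr => i _.
rewrite mulrBl tB !zE // -rmorphB /= kE.
rewrite mulrCA (mulrCA a) mulVKf // mulrA.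
by rewrite scaler_int -[M.+1%:R]/(M.+1%:Z%:~R) -intrM mulrzl.
Qed.

End FiniteResidues.

(** * Ideal arithmetic *)

Section IdealArithmetic.
Variable K : fieldExtType rat.
Implicit Types (A B C I P : set K).
Local Notation OK := (@ring_of_integers K).
Local Notation "A ** B" := (ideal_mul A B) (at level 40, left associativity).

Lemma OK_submodule_OK : OK_submodule OK.
Proof. by split; [exact: OK0|exact: OKD|exact: OKM]. Qed.

Lemma ideal_mul_in A B a b : A a -> B b -> (A ** B) (a * b).
Proof.
move=> Aa Bb; exists [:: (a, b)]; split; last by rewrite big_seq1.
by move=> p; rewrite inE => /eqP ->.
Qed.

Lemma ideal_mul0 A B : (A ** B) 0.
Proof. by exists [::]; rewrite big_nil. Qed.

Lemma ideal_mulD A B x y : (A ** B) x -> (A ** B) y -> (A ** B) (x + y).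
Proof.
move=> [s [sAB ->]] [t [tAB ->]]; exists (s ++ t); split; last by rewrite big_cat.
by move=> p; rewrite mem_cat => /orP[/sAB|/tAB].
Qed.

Lemma ideal_mul_ind A B C :
  C 0 -> (forall x y, C x -> C y -> C (x + y)) ->
  (forall a b, A a -> B b -> C (a * b)) -> A ** B `<=` C.
Proof.
move=> C0 CD CM _ [s [sAB ->]]; rewrite big_seq.
by elim/big_ind: _ => // p /sAB[]; exact: CM.
Qed.

Lemma ideal_mulC : commutative (@ideal_mul K).
Proof.
suff mulC A B : A ** B `<=` B ** A by move=> A B; apply/seteqP; split; exact: mulC.
apply: ideal_mul_ind; [exact: ideal_mul0|exact: ideal_mulD|].
by move=> a b Aa Bb; rewrite mulrC; exact: ideal_mul_in.
Qed.

Lemma ideal_mulA : associative (@ideal_mul K).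
Proof.
suff mulA A B C : A ** (B ** C) `<=` A ** B ** C.
  move=> A B C; apply/seteqP; split; first exact: mulA.
  by rewrite (ideal_mulC _ C) (ideal_mulC A B) (ideal_mulC A) (ideal_mulC B C); exact: mulA.
apply: ideal_mul_ind; [exact: ideal_mul0|exact: ideal_mulD|].
move=> a b Aa; move: b.
apply: (@ideal_mul_ind _ _ (fun y => (A ** B ** C) (a * y))).
- by rewrite mulr0; exact: ideal_mul0.
- by move=> x y; rewrite mulrDr; exact: ideal_mulD.
- by move=> b c Bb Cc; rewrite mulrA; apply: ideal_mul_in => //; exact: ideal_mul_in.
Qed.

HB.instance Definition _ :=
  SemiGroup.isComLaw.Build (set K) (@ideal_mul K) ideal_mulA ideal_mulC.

Lemma ideal_mul_submodule A B : OK_submodule A -> OK_submodule (A ** B).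
Proof.
move=> [_ _ AM]; split; [exact: ideal_mul0|by move=> x y; exact: ideal_mulD|].
move=> a x Oa; move: x; apply: (@ideal_mul_ind _ _ (fun y => (A ** B) (a * y))).
- by rewrite mulr0; exact: ideal_mul0.
- by move=> x y; rewrite mulrDr; exact: ideal_mulD.
- by move=> b c Ab Bc; rewrite mulrA; apply: ideal_mul_in => //; exact: AM.
Qed.

Lemma OK_mul A : OK_submodule A -> OK ** A = A.
Proof.
move=> [A0 AD AM]; apply/seteqP; split; first exact: ideal_mul_ind.
by move=> a Aa; rewrite -[a]mul1r; apply: ideal_mul_in => //; exact: OK1.
Qed.

Lemma ideal_mulS A B C : OK_submodule C -> (forall a b, A a -> B b -> C (a * b)) ->
  A ** B `<=` C.
Proof. by move=> [C0 CD _]; exact: ideal_mul_ind. Qed.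

Lemma ideal_mul_integral A B : A `<=` OK -> B `<=` OK -> A ** B `<=` OK.
Proof.
move=> AO BO; apply: ideal_mulS => [|a b /AO Oa /BO Ob]; first exact: OK_submodule_OK.
exact: OKM.
Qed.

Lemma ideal_mul_subl A B : OK_submodule A -> B `<=` OK -> A ** B `<=` A.
Proof.
move=> sA BO; apply: ideal_mulS => // a b Aa /BO Ob.
by rewrite mulrC; case: sA => _ _; apply.
Qed.

Lemma ideal_inv_submodule A : OK_submodule (ideal_inv A).
Proof.
split=> [a _|x y xA yA a Aa|b x Ob xA a Aa].
- by rewrite mul0r; exact: OK0.
- by rewrite mulrDl; apply: OKD; [exact: xA|exact: yA].
- by rewrite -mulrA; apply: OKM => //; exact: xA.
Qed.

Lemma ideal_inv1 A : A `<=` OK -> ideal_inv A 1.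
Proof. by move=> AO a /AO; rewrite mul1r. Qed.

Lemma ideal_mul_inv_integral A : A ** ideal_inv A `<=` OK.
Proof.
by apply: ideal_mulS => [|a b Aa]; [exact: OK_submodule_OK|rewrite mulrC; apply].
Qed.

Lemma ideal_exp_submodule A k : OK_submodule A -> OK_submodule (ideal_exp A k).
Proof.
move=> sA; case: k => [[|k]|k] /=.
- exact: OK_submodule_OK.
- exact: ideal_mul_submodule.
- exact/ideal_mul_submodule/ideal_inv_submodule.
Qed.

Section Invertible.
Variable P : set K.
Hypotheses (sP : OK_submodule P) (PV : P ** ideal_inv P = OK).

Lemma ideal_mulK A : OK_submodule A -> ideal_inv P ** (P ** A) = A.
Proof. by move=> sA; rewrite ideal_mulA (ideal_mulC _ P) PV OK_mul. Qed.

Lemma ideal_mulVK A : OK_submodule A -> P ** (ideal_inv P ** A) = A.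
Proof. by move=> sA; rewrite ideal_mulA PV OK_mul. Qed.

Lemma ideal_expS k : ideal_exp P (k + 1) = P ** ideal_exp P k.
Proof.
case: k => [k|[|k]]; first by rewrite -PoszD addn1.
- rewrite NegzE addNr /= ideal_mulVK //; exact: OK_submodule_OK.
- rewrite (_ : Negz k.+1 + 1 = Negz k); last by rewrite !NegzE -[k.+2]addn1 PoszD opprD addrNK.
  by rewrite [in RHS]/= ideal_mulVK //; exact: (ideal_exp_submodule (Negz k)).
Qed.

Lemma ideal_expB1 k : ideal_exp P (k - 1) = ideal_inv P ** ideal_exp P k.
Proof. by rewrite -{2}(subrK 1 k) ideal_expS ideal_mulK //; exact: ideal_exp_submodule. Qed.

Lemma ideal_expD (m : nat) (k : int) : ideal_exp P (k + m) = ideal_exp P m ** ideal_exp P k.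
Proof.
elim: m => [|m IH]; first by rewrite addr0 OK_mul //; exact: (ideal_exp_submodule k sP).
by rewrite -addn1 PoszD addrA !ideal_expS IH ideal_mulA.
Qed.

Lemma ideal_exp_cancel k A B : OK_submodule A -> OK_submodule B ->
  ideal_exp P k ** A = ideal_exp P k ** B -> A = B.
Proof.
move=> sA sB; elim/int_rect: k => [|k IH|k IH].
- by rewrite /= !OK_mul.
- rewrite -addn1 PoszD ideal_expS -!ideal_mulA => /(congr1 (ideal_mul (ideal_inv P))).
  by rewrite !ideal_mulK //; exact/ideal_mul_submodule/ideal_exp_submodule.
- rewrite -addn1 PoszD opprD ideal_expB1 -!ideal_mulA => /(congr1 (ideal_mul P)).
  by rewrite !ideal_mulVK //; exact/ideal_mul_submodule/ideal_exp_submodule.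
Qed.

End Invertible.

End IdealArithmetic.

(** * Unique factorization *)

Section Dedekind.
Variable K : fieldExtType rat.
Implicit Types (A B C I P Q X Y : set K).
Local Notation OK := (@ring_of_integers K).
Local Notation "A ** B" := (ideal_mul A B) (at level 40, left associativity).

Hypothesis OK_residues : forall a : K, a != 0 ->
  exists (T : finType) (f : K -> T), forall x y, OK x -> OK y -> f x = f y ->
    exists2 c, OK c & x - y = a * c.

Lemma pigeonhole (a : K) (u : nat -> K) : a != 0 -> (forall n, OK (u n)) ->
  exists i j c, [/\ (i < j)%N, OK c & u i - u j = a * c].
Proof.
move=> /OK_residues[T [f fP]] uO.
have /injectivePn[i [j ij fij]] : ~~ injectiveb (fun i : 'I_(#|T|.+1) => f (u i)).
  by apply/injectiveP => /leq_card; rewrite card_ord ltnn.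
wlog ltij : i j ij fij / (i < j)%N => [H|].
  have /orP[|] : (i < j)%N || (j < i)%N by rewrite -neq_ltn.
    exact: H.
  by apply: H; rewrite // eq_sym.
have [c Oc uE] := fP _ _ (uO i) (uO j) fij.
by exists i, j, c.
Qed.

Definition integral_ideal A := OK_submodule A /\ A `<=` OK.

Definition nonzero_prime P := prime_ideal P /\ nonzero_ideal P.

Lemma ideal_family_maximal (S : set (set K)) (a : K) A0 :
  a != 0 -> (forall A, S A -> integral_ideal A /\ A a) -> S A0 ->
  exists M, [/\ S M, A0 `<=` M & forall A, S A -> M `<=` A -> A `<=` M].
Proof.
move=> /OK_residues[T [f fP]] SP SA0.
(* The number of residue classes modulo a met by A is strictly monotone on S. *)
pose mu A := #|[set t : T | `[< exists2 x, A x & f x = t >]]%SET|.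
have mu_lt A B : S A -> S B -> A `<=` B -> ~ B `<=` A -> (mu A < mu B)%N.
  move=> /SP[[sA AO] Aa] /SP[[sB BO] _] AB nBA.
  apply: proper_card; apply/properP; split.
    by apply/fintype.subsetP => t; rewrite !inE => -[x /AB Bx <-]; exists x.
  have [b [Bb nAb]] := nonsubset nBA.
  exists (f b); first by rewrite !inE; exists b.
  apply/negP; rewrite !inE => -[x Ax fxb]; apply: nAb.
  have [c Oc bE] := fP _ _ (BO _ Bb) (AO _ Ax) (esym fxb).
  have -> : b = x + c * a by rewrite mulrC -bE addrC subrK.
  by case: (sA) => _ AD AM; apply: AD => //; exact: AM.
have [n le_n] : exists n, (#|T| - mu A0 <= n)%N by exists (#|T| - mu A0)%N.
elim: n A0 SA0 le_n => [|n IH] A0 SA0 le_n.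
  exists A0; split=> // A SA A0A; apply: contrapT => nAA0.
  have := mu_lt _ _ SA0 SA A0A nAA0.
  by rewrite ltnNge (leq_trans (max_card _)) // -subn_eq0 -leqn0.
have [[A [SA A0A nAA0]]|max] := pselect (exists A, [/\ S A, A0 `<=` A & ~ A `<=` A0]).
  have [|M [SM AM Mmax]] := IH A SA.
    have := mu_lt _ _ SA0 SA A0A nAA0; move: le_n; clear; lia.
  by exists M; split=> //; exact: subset_trans AM.
exists A0; split=> // A SA A0A; apply: contrapT => nAA0; apply: max; by exists A.
Qed.

Lemma OK_stable A x : integral_ideal A -> nonzero_ideal A ->
  (forall a, A a -> A (x * a)) -> OK x.
Proof.
move=> [sA AO] [a Aa a0] xA.
have xkA k : A (x ^+ k * a).
  by elim: k => [|k IH]; rewrite ?mul1r // exprS -mulrA; exact: xA.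
have [i [j [c [ij Oc xE]]]] := pigeonhole a0 (fun k => AO _ (xkA k)).
have {}xE : x ^+ i - x ^+ j = c.
  by apply: (mulIf a0); rewrite mulrBl xE mulrC.
apply: (@OK_monic_root _ ('X^j + (c%:P - 'X^i))).
- rewrite monicE lead_coefDl ?lead_coefXn // size_polyXn.
  apply: (leq_ltn_trans (size_polyD _ _)); rewrite size_polyN size_polyXn gtn_max !ltnS ij andbT.
  by apply: (leq_trans (size_polyC_leq1 _)); lia.
- by rewrite rootE !(hornerD, hornerN, hornerXn, hornerC) -xE; apply/eqP; ring.
- move=> k; rewrite coefD coefB !coefXn coefC.
  apply: OKD; first exact: (OK_int _ (k == j)%N).
  apply: OKD; first by case: ifP => _ //; exact: OK0.
  by apply: OKN; exact: (OK_int _ (k == i)%N).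
Qed.

Lemma powers_repeat a y : a != 0 -> OK y ->
  exists i n c, [/\ OK c, (0 < n)%N & y ^+ i * (1 - y ^+ n) = a * c].
Proof.
move=> a0 Oy; have [i [j [c [ij Oc yE]]]] := pigeonhole a0 (fun k => OKX k Oy).
exists i, (j - i)%N, c; split; rewrite ?subn_gt0 //.
by rewrite mulrBr mulr1 -exprD subnKC // ltnW.
Qed.

Lemma prime_maximal P B y : nonzero_prime P -> integral_ideal B -> P `<=` B ->
  B y -> ~ P y -> B 1.
Proof.
move=> pP [sB BO] PB By nPy; case: (pP) => -[sP PO nP1 Pmul] [a Pa a0].
have Oy := BO _ By.
have [i [n [c [Oc n0 yE]]]] := powers_repeat a0 Oy.
have nPyi k : ~ P (y ^+ k).
  by elim: k => [|k IH] //; rewrite exprS => /(Pmul _ _ Oy (OKX k Oy))[].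
have Py1 : P (y ^+ i * (1 - y ^+ n)).
  by rewrite yE mulrC; case: sP => _ _; apply.
have O1y : OK (1 - y ^+ n) by apply: OKD; [exact: OK1|apply/OKN/OKX].
case: (Pmul _ _ (OKX i Oy) O1y Py1) => [/nPyi //|/PB B1y].
rewrite -(subrK (y ^+ n) 1); case: (sB) => _ BD BM; apply: BD => //.
by rewrite -(prednK n0) exprSr; apply: BM => //; exact: OKX.
Qed.

(* A maximal ideal of the form (a : c) among those contained in P equals P. *)
Lemma prime_annihilator P a : nonzero_prime P -> P a -> a != 0 ->
  exists c, [/\ OK c, ~ (exists2 d, OK d & c = a * d)
    & forall x, P x -> exists2 d, OK d & x * c = a * d].
Proof.
move=> pP Pa a0; case: (pP) => -[sP PO nP1 Pmul] _.
pose ann c : set K := [set x | OK x /\ exists2 d, OK d & x * c = a * d].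
have annM c u x : OK u -> ann c x -> ann (u * c) x.
  move=> Ou [Ox [d Od xE]]; split=> //; exists (u * d); first exact: OKM.
  by rewrite mulrCA xE mulrCA.
pose S A := exists c, [/\ OK c, A = ann c & A `<=` P].
have S_ideal A : S A -> integral_ideal A /\ A a.
  move=> [c [Oc -> _]]; split; last by split; [exact: PO|exists c].
  split; last by move=> x [].
  split; first by split; [exact: OK0|exists 0; [exact: OK0|rewrite mul0r mulr0]].
    move=> x y [Ox [d Od xE]] [Oy [e Oe yE]]; split; first exact: OKD.
    by exists (d + e); [exact: OKD|rewrite mulrDl xE yE mulrDr].
  move=> b x Ob [Ox [d Od xE]]; split; first exact: OKM.
  by exists (b * d); [exact: OKM|rewrite -mulrA xE mulrCA].
have S1 : S (ann 1).
  exists 1; split=> [||x [_ [d Od]]] //; first exact: OK1.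
  by rewrite mulr1 => ->; rewrite mulrC; case: sP => _ _; apply.
have [_ [[c [Oc -> cP]] _ cmax]] := ideal_family_maximal a0 S_ideal S1.
have ann_stable u : OK u -> ann (u * c) `<=` P -> ann (u * c) `<=` ann c.
  move=> Ou ucP; apply: cmax; last by move=> x; exact: annM.
  by exists (u * c); split=> //; exact: OKM.
have ann_coprime u : OK u -> ~ P u -> ann (u * c) `<=` ann c.
  move=> Ou nPu; apply: ann_stable => // x [Ox xuc].
  have /cP/Pmul[] // : ann c (x * u).
  by split; [exact: OKM|rewrite -mulrA].
have nc : ~ (exists2 d, OK d & c = a * d).
  by move=> cE; apply: nP1; apply: cP; split; [exact: OK1|rewrite mul1r].
exists c; split=> // y Py; have Oy := PO _ Py.
have [i [n [d [Od n0 yE]]]] := powers_repeat a0 Oy.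
have : ann c (y ^+ i).
  apply: (ann_coprime (1 - y ^+ n)).
  - by apply: OKD; [exact: OK1|apply/OKN/OKX].
  - move=> P1y; apply: nP1; rewrite -(subrK (y ^+ n) 1); case: (sP) => _ PD PM; apply: PD => //.
    by rewrite -(prednK n0) exprSr; apply: PM => //; exact: OKX.
  - split; first exact: OKX.
    by exists (d * c); [exact: OKM|rewrite mulrA yE mulrA].
elim: i {yE} => [[_ [e Oe]]|i IH yi].
  by rewrite mul1r => cE; case: nc; exists e.
have [yi'|nyi] := pselect (ann c (y ^+ i)); first exact: IH.
suff : ann c y by case.
apply: (ann_stable (y ^+ i)); first exact: OKX.
  move=> z [Oz [e Oe zE]]; apply: contrapT => nPz; apply: nyi.
  apply: (ann_coprime z) => //; split; first exact: OKX.
  by exists e => //; rewrite mulrCA.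
case: yi => _ [e Oe]; rewrite exprS -mulrA => yE.
by split => //; exists e.
Qed.

Lemma prime_invertible P : nonzero_prime P -> P ** ideal_inv P = OK.
Proof.
move=> pP; case: (pP) => -[sP PO nP1 Pmul] [a Pa a0].
have [c [Oc nc cP]] := prime_annihilator pP Pa a0.
have QO : P ** ideal_inv P `<=` OK by exact: ideal_mul_inv_integral.
have sQ : OK_submodule (P ** ideal_inv P) by exact: ideal_mul_submodule.
have xP : ideal_inv P (c / a).
  by move=> x /cP[d Od xE]; rewrite mulrAC (mulrC c) xE mulrAC divff // mul1r.
have PQ : P `<=` P ** ideal_inv P.
  by move=> x Px; rewrite -[x]mulr1; apply: ideal_mul_in => //; exact: ideal_inv1.
suff Q1 : (P ** ideal_inv P) 1.
  by apply/seteqP; split=> // x Ox; rewrite -[x]mulr1; case: sQ => _ _; apply.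
have [QP|nQP] := pselect (P ** ideal_inv P `<=` P).
  case: nc; exists (c / a); last by rewrite mulrCA divff ?mulr1.
  apply: (@OK_stable P) => // [|x Px]; first by exists a.
  by rewrite mulrC; apply: QP; exact: ideal_mul_in.
have [y [Qy nPy]] := nonsubset nQP.
exact: prime_maximal nPy.
Qed.

Lemma prime_above A a : integral_ideal A -> A a -> a != 0 -> ~ A 1 ->
  exists2 P, nonzero_prime P & A `<=` P.
Proof.
move=> iA Aa a0 nA1.
pose S B := [/\ integral_ideal B, B a & ~ B 1].
have S_ideal B : S B -> integral_ideal B /\ B a by case.
have SA : S A by split.
have [M [[[sM MO] Ma nM1] AM Mmax]] := ideal_family_maximal a0 S_ideal SA.
exists M => //; split; last by exists a.
split=> // x y Ox Oy Mxy; apply: contrapT => /not_orP[nMx nMy].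
pose B : set K := [set z | exists m b, [/\ M m, OK b & z = m + b * x]].
have MB : M `<=` B.
  by move=> m Mm; exists m, 0; split=> //; [exact: OK0|rewrite mul0r addr0].
case: (sM) => M0 MD MM.
have Bx : B x by exists 0, 1; split=> //; [exact: OK1|rewrite add0r mul1r].
have iB : integral_ideal B.
  split; last by move=> _ [m [b [/MO Om Ob ->]]]; apply: OKD => //; exact: OKM.
  split; first exact: MB.
    move=> _ _ [m [b [Mm Ob ->]]] [m' [b' [Mm' Ob' ->]]].
    exists (m + m'), (b + b'); split; [exact: MD|exact: OKD|].
    by rewrite mulrDl addrACA.
  move=> d _ Od [m [b [Mm Ob ->]]]; exists (d * m), (d * b).
  by split; [exact: MM|exact: OKM|rewrite mulrDr mulrA].
have [m [b [Mm Ob E]]] : B 1.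
  apply: contrapT => nB1; apply: nMx; apply: (Mmax B) => //.
  by split=> //; exact: MB.
apply: nMy; rewrite -[y]mul1r E mulrDl; apply: MD.
  by rewrite mulrC; exact: MM.
by rewrite -mulrA; exact: MM.
Qed.

Lemma big_ideal_exp_submodule (s : seq (set K)) (e : set K -> int) :
  (forall P, P \in s -> OK_submodule P) ->
  OK_submodule (\big[@ideal_mul K/OK]_(P <- s) ideal_exp P (e P)).
Proof.
elim: s => [|P s IH] sP; first by rewrite big_nil; exact: OK_submodule_OK.
by rewrite big_cons; apply/ideal_mul_submodule/ideal_exp_submodule/sP; rewrite mem_head.
Qed.

Lemma nonzero_prime_submodule (s : seq (set K)) :
  (forall P, P \in s -> nonzero_prime P) -> forall P, P \in s -> OK_submodule P.
Proof. by move=> sP P /sP[[]]. Qed.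

Lemma prime_factorization_split I e P : nonzero_prime P -> prime_factorization I e ->
  exists s, [/\ uniq (P :: s), forall Q, Q \in s -> nonzero_prime Q,
    forall Q, Q \notin P :: s -> e Q = 0
    & I = ideal_exp P (e P) ** \big[@ideal_mul K/OK]_(Q <- s) ideal_exp Q (e Q)].
Proof.
move=> pP [s [us sP e0 ->]]; have [Ps|nPs] := boolP (P \in s).
  exists (rem P s); split.
  - by rewrite /= mem_rem_uniqF // rem_uniq.
  - by move=> Q /mem_rem /sP.
  - by move=> Q; rewrite -(perm_mem (perm_to_rem Ps)); exact: e0.
  - by rewrite (perm_big _ (perm_to_rem Ps)) big_cons.
exists s; split; rewrite /= ?nPs //.
- by move=> Q; rewrite inE => /norP[_]; exact: e0.
- rewrite e0 // OK_mul //; apply: big_ideal_exp_submodule.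
  exact: nonzero_prime_submodule.
Qed.

Lemma prime_factorization_shift I e P X (d : int) : nonzero_prime P ->
  (forall k, ideal_exp P (k + d) = X ** ideal_exp P k) ->
  prime_factorization I e ->
  prime_factorization (X ** I) (fun Q => if Q == P then e P + d else e Q).
Proof.
move=> pP PX /(prime_factorization_split pP)[s [us sP e0 ->]].
exists (P :: s); split=> //.
- by move=> Q; rewrite inE => /predU1P[->|/sP].
- move=> Q nQ; case: eqP => [QP|_]; last exact: e0.
  by move: nQ; rewrite QP mem_head.
- rewrite big_cons eqxx PX ideal_mulA; congr (_ ** _).
  apply: eq_big_seq => Q Qs; case: eqP => // QP.
  by move: us; rewrite /= -QP Qs.
Qed.

Definition has_factorization I := exists e, prime_factorization I e.

Lemma has_factorization_OK : has_factorization OK.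
Proof. by exists (fun=> 0), [::]; split=> //; rewrite big_nil. Qed.

Lemma has_factorization_mul P I : nonzero_prime P -> has_factorization I ->
  has_factorization (P ** I).
Proof.
move=> pP [e eI]; eexists; apply: (prime_factorization_shift pP _ eI) => k.
apply: ideal_expS; last exact: prime_invertible.
by case: pP => -[].
Qed.

Lemma has_factorization_mulV P I : nonzero_prime P -> has_factorization I ->
  has_factorization (ideal_inv P ** I).
Proof.
move=> pP [e eI]; eexists; apply: (prime_factorization_shift pP _ eI) => k.
apply: ideal_expB1; last exact: prime_invertible.
by case: pP => -[].
Qed.

Lemma integral_ideal_primes A : integral_ideal A -> nonzero_ideal A ->
  exists2 l : seq (set K), (forall P, P \in l -> nonzero_prime P)
    & A = foldr (@ideal_mul K) OK l.
Proof.
move=> iA [a Aa a0]; apply: contrapT => nA.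
pose S B := [/\ integral_ideal B, B a & ~ exists2 l : seq (set K),
  (forall P, P \in l -> nonzero_prime P) & B = foldr (@ideal_mul K) OK l].
have S_ideal B : S B -> integral_ideal B /\ B a by case.
have [|M [[iM Ma nM] _ Mmax]] := ideal_family_maximal a0 S_ideal (_ : S A).
  by split.
case: (iM) => sM MO.
have nM1 : ~ M 1.
  move=> M1; apply: nM; exists [::] => //=; apply/seteqP; split=> // x Ox.
  by rewrite -[x]mulr1; case: sM => _ _; apply.
have [P pP MP] := prime_above iM Ma a0 nM1.
have [[sP PO nP1 _] _] := pP.
have PV := prime_invertible pP.
pose B := ideal_inv P ** M.
have BO : B `<=` OK.
  rewrite /B ideal_mulC -PV (ideal_mulC P).
  rewrite ideal_mulC; apply: ideal_mulS.
    exact/ideal_mul_submodule/ideal_inv_submodule.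
  by move=> x y Px My; apply: ideal_mul_in => //; exact: MP.
have MB : M `<=` B.
  by move=> x Mx; rewrite -[x]mul1r; apply: ideal_mul_in => //; exact: ideal_inv1.
have sB : OK_submodule B by exact/ideal_mul_submodule/ideal_inv_submodule.
have [[l lP BE]|nB] := pselect (exists2 l : seq (set K),
    (forall Q, Q \in l -> nonzero_prime Q) & B = foldr (@ideal_mul K) OK l).
  apply: nM; exists (P :: l) => /=.
    by move=> Q; rewrite inE => /predU1P[->|/lP].
  by rewrite -BE ideal_mulVK.
have BM : B `<=` M by apply: Mmax => //; split=> //; exact: MB.
apply: nP1; suff : OK `<=` P by apply; exact: OK1.
rewrite -{1}PV; apply: ideal_mul_subl => // x Px.
apply: (OK_stable iM); first by exists a.
by move=> y My; apply: BM; exact: ideal_mul_in.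
Qed.

Lemma fractional_ideal_factorization I : fractional_ideal I -> nonzero_ideal I ->
  has_factorization I.
Proof.
move=> [sI [d [Od d0 dI]]] [y Iy y0]; case: (sI) => I0 ID IM.
pose J : set K := [set d * x | x in I].
pose D : set K := [set d * x | x in OK].
have sJ : OK_submodule J.
  split; first by exists 0; rewrite ?mulr0.
    by move=> _ _ [u Iu <-] [v Iv <-]; exists (u + v); rewrite ?mulrDr //; exact: ID.
  by move=> a _ Oa [u Iu <-]; exists (a * u); [exact: IM|rewrite mulrCA].
have sD : OK_submodule D.
  split; first by exists 0; [exact: OK0|rewrite mulr0].
    by move=> _ _ [u Ou <-] [v Ov <-]; exists (u + v); rewrite ?mulrDr //; exact: OKD.
  by move=> a _ Oa [u Ou <-]; exists (a * u); [exact: OKM|rewrite mulrCA].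
have JO : J `<=` OK by move=> _ [x /dI dx <-].
have DO : D `<=` OK by move=> _ [x Ox <-]; exact: OKM.
have nJ : nonzero_ideal J by exists (d * y); [exists y|rewrite mulf_neq0].
have nD : nonzero_ideal D by exists d => //; exists 1; [exact: OK1|rewrite mulr1].
have [l lP JE] := integral_ideal_primes (conj sJ JO) nJ.
have [m mP DE] := integral_ideal_primes (conj sD DO) nD.
have DI : D ** I = J.
  apply/seteqP; split; last first.
    move=> _ [x Ix <-]; apply: ideal_mul_in => //; exists 1; [exact: OK1|exact: mulr1].
  apply: ideal_mulS => // _ x [u Ou <-] Ix; exists (u * x); last by rewrite mulrA.
  exact: IM.
have fJ : has_factorization J.
  rewrite JE; elim: l {JE} lP => [|P l IH] lP; first exact: has_factorization_OK.
  apply: has_factorization_mul; first by apply: lP; rewrite mem_head.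
  by apply: IH => Q Ql; apply: lP; rewrite inE Ql orbT.
move: fJ; rewrite -DI DE; elim: m {DE} mP => [|P m IH] mP /=; first by rewrite OK_mul.
have pP : nonzero_prime P by apply: mP; rewrite mem_head.
move=> /(has_factorization_mulV pP).
have [[sP _ _ _] _] := pP.
rewrite -ideal_mulA ideal_mulK //.
- by apply: IH => Q Qm; apply: mP; rewrite inE Qm orbT.
- exact: prime_invertible.
- by rewrite ideal_mulC; exact: ideal_mul_submodule.
Qed.

(* Valuation 0 at P, expressed without the valuation, which is not yet known to be
   well defined. *)
Definition prime_to P X := exists C D,
  [/\ integral_ideal C, integral_ideal D, ~ C `<=` P, ~ D `<=` P & X ** D = C].

Lemma not_subset_mul P A B : nonzero_prime P -> A `<=` OK -> B `<=` OK ->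
  ~ A `<=` P -> ~ B `<=` P -> ~ A ** B `<=` P.
Proof.
move=> [[_ _ _ Pmul] _] AO BO /nonsubset[a [Aa nPa]] /nonsubset[b [Bb nPb]] ABP.
by case: (Pmul _ _ (AO _ Aa) (BO _ Bb) (ABP _ (ideal_mul_in Aa Bb))).
Qed.

Lemma integral_ideal_mul A B : integral_ideal A -> integral_ideal B ->
  integral_ideal (A ** B).
Proof.
by move=> [sA AO] [sB BO]; split; [exact: ideal_mul_submodule|exact: ideal_mul_integral].
Qed.

Lemma integral_OK : integral_ideal OK.
Proof. by split=> //; exact: OK_submodule_OK. Qed.

Lemma prime_not_sup_OK P : nonzero_prime P -> ~ OK `<=` P.
Proof. by move=> [[_ _ nP1 _] _] /(_ 1 (@OK1 K)). Qed.

Lemma prime_to_OK P : nonzero_prime P -> prime_to P OK.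
Proof.
move=> pP; exists OK, OK; split; [exact: integral_OK|exact: integral_OK| | |].
- exact: prime_not_sup_OK.
- exact: prime_not_sup_OK.
- by rewrite OK_mul //; exact: OK_submodule_OK.
Qed.

Lemma prime_to_mul P X Y : nonzero_prime P -> prime_to P X -> prime_to P Y ->
  prime_to P (X ** Y).
Proof.
move=> pP [C [D [iC iD nC nD XE]]] [C' [D' [iC' iD' nC' nD' YE]]].
exists (C ** C'), (D ** D'); split; try exact: integral_ideal_mul.
- by apply: not_subset_mul => //; [case: iC|case: iC'].
- by apply: not_subset_mul => //; [case: iD|case: iD'].
- by rewrite -XE -YE -!ideal_mulA; congr (_ ** _); rewrite !ideal_mulA (ideal_mulC Y).
Qed.

Lemma prime_to_exp P Q k : nonzero_prime P -> nonzero_prime Q -> Q != P ->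
  prime_to P (ideal_exp Q k).
Proof.
move=> pP pQ QP; have [[sQ QO nQ1 _] _] := pQ; have [[sP PO nP1 _] _] := pP.
have iQ : integral_ideal Q by [].
have nQP : ~ Q `<=` P.
  move=> QsP; have nPQ : ~ P `<=` Q.
    by move=> PsQ; case/eqP: QP; apply/seteqP.
  have [y [Py nQy]] := nonsubset nPQ.
  exact/nP1/(prime_maximal pQ (conj sP PO) QsP Py nQy).
have pQP : prime_to P Q.
  exists Q, OK; split=> //; [exact: integral_OK|exact: prime_not_sup_OK|].
  by rewrite ideal_mulC OK_mul.
have pVQP : prime_to P (ideal_inv Q).
  exists OK, Q; split=> //; [exact: integral_OK|exact: prime_not_sup_OK|].
  by rewrite ideal_mulC; exact: prime_invertible.
have pow X m : prime_to P X -> prime_to P (iter m (ideal_mul X) OK).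
  move=> pX; elim: m => [|m IH] /=; [exact: prime_to_OK|exact: prime_to_mul].
by case: k => k; exact: pow.
Qed.

Lemma prime_to_big P (s : seq (set K)) e : nonzero_prime P -> P \notin s ->
  (forall Q, Q \in s -> nonzero_prime Q) ->
  prime_to P (\big[@ideal_mul K/OK]_(Q <- s) ideal_exp Q (e Q)).
Proof.
move=> pP; elim: s => [|Q s IH] /=; first by rewrite big_nil => _ _; exact: prime_to_OK.
rewrite inE big_cons => /norP[PQ Ps] sP; apply: prime_to_mul => //.
  by apply: prime_to_exp; rewrite 1?eq_sym //; apply: sP; rewrite mem_head.
by apply: IH => // R Rs; apply: sP; rewrite inE Rs orbT.
Qed.

Lemma prime_to_exp_inj P X Y (k l : int) : nonzero_prime P ->
  OK_submodule X -> OK_submodule Y -> prime_to P X -> prime_to P Y ->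
  ideal_exp P k ** X = ideal_exp P l ** Y -> k = l.
Proof.
move=> pP; have [[sP PO nP1 _] _] := pP; have PV := prime_invertible pP.
wlog klt : k l X Y / (k < l)%R => [H|] sX sY pX pY E.
  case: (ltgtP k l) => // lt; first exact: (H k l X Y).
  by apply/esym; exact: (H l k Y X).
have [m lE] : exists m : nat, l = k + m.+1%:Z.
  by exists (`|l - k|%N.-1); lia.
move: E; rewrite lE ideal_expD // (ideal_mulC (ideal_exp P m.+1)) -ideal_mulA.
move=> /(ideal_exp_cancel sP PV sX) XE.
have {}XE : X = ideal_exp P m.+1 ** Y by apply: XE; exact/ideal_mul_submodule/ideal_exp_submodule.
have iPm : integral_ideal (ideal_exp P m).
  elim: m {lE XE} => [|m IH]; first exact: integral_OK.
  exact: integral_ideal_mul.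
case: pX pY => [C [D [iC iD nC nD CE]]] [C' [D' [iC' iD' nC' nD' CE']]].
case: (not_subset_mul pP (proj2 iC) (proj2 iD') nC nD').
have -> : C ** D' = P ** (ideal_exp P m ** (C' ** D)).
  by rewrite -CE XE /= -CE' -!ideal_mulA (ideal_mulC D).
apply: ideal_mul_subl => //.
by case: (integral_ideal_mul iPm (integral_ideal_mul iC' iD)).
Qed.

Lemma prime_factorization_unique I e e' :
  prime_factorization I e -> prime_factorization I e' -> e = e'.
Proof.
move=> eI eI'; apply/funext => P.
have [pP|npP] := pselect (nonzero_prime P); last first.
  have pf0 f : prime_factorization I f -> f P = 0.
    by move=> [s [_ sP f0 _]]; apply: f0; apply/negP => /sP.
  by rewrite !pf0.
have [s [/andP[Ps us] sP _ IE]] := prime_factorization_split pP eI.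
have [s' [/andP[Ps' us'] sP' _ IE']] := prime_factorization_split pP eI'.
apply: (@prime_to_exp_inj P _ _ _ _ pP _ _ _ _ (etrans (esym IE) IE')).
- exact/big_ideal_exp_submodule/nonzero_prime_submodule.
- exact/big_ideal_exp_submodule/nonzero_prime_submodule.
- exact: prime_to_big.
- exact: prime_to_big.
Qed.

Lemma prime_factorization_inj I J e :
  prime_factorization I e -> prime_factorization J e -> I = J.
Proof.
have support (s : seq (set K)) : (forall P, P \in s -> nonzero_prime P) ->
    \big[@ideal_mul K/OK]_(P <- s) ideal_exp P (e P) =
    \big[@ideal_mul K/OK]_(P <- [seq P <- s | e P != 0]) ideal_exp P (e P).
  elim: s => [//|P s IH] sP /=.
  have sP' Q : Q \in s -> nonzero_prime Q by move=> Qs; apply: sP; rewrite inE Qs orbT.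
  rewrite big_cons; case: eqP => [->|_] /=; last by rewrite big_cons IH.
  by rewrite -IH // OK_mul //; exact/big_ideal_exp_submodule/nonzero_prime_submodule.
move=> [s [us sP e0 ->]] [s' [us' sP' e0' ->]].
rewrite (support s) // (support s') //; apply: perm_big.
apply: uniq_perm; rewrite ?filter_uniq // => P; rewrite !mem_filter.
have [//|eP] := eqVneq (e P) 0.
have -> : P \in s by apply: contraNT eP => /e0 ->.
by have -> : P \in s' by apply: contraNT eP => /e0' ->.
Qed.

Lemma ideal_valuationE I e : prime_factorization I e -> ideal_valuation I = e.
Proof.
by move=> eI; apply: (prime_factorization_unique _ eI); apply: xgetPex; exists e.
Qed.

End Dedekind.

(** * The Galois action and the lattice *)

Section Transport.
Variable K : fieldExtType rat.
Variables f g : {rmorphism K -> K}.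
Hypotheses (fK : cancel f g) (gK : cancel g f).
Implicit Types (A B I P : set K).
Local Notation OK := (@ring_of_integers K).
Local Notation "A ** B" := (ideal_mul A B) (at level 40, left associativity).

Lemma image_OK : f @` OK = OK.
Proof.
apply/seteqP; split=> [_ [x Ox <-]|x Ox]; first exact: OK_rmorph.
by exists (g x); [exact: OK_rmorph|exact: gK].
Qed.

Lemma image_cancel A : f @` (g @` A) = A.
Proof.
apply/seteqP; split=> [_ [_ [x Ax <-] <-]|x Ax]; first by rewrite gK.
by exists (g x) => //; exists x.
Qed.

Lemma image_ideal_mul A B : f @` (A ** B) = f @` A ** f @` B.
Proof.
apply/seteqP; split=> [_ [x ABx <-]|].
  move: x ABx; apply: (@ideal_mul_ind _ _ _ (fun x => (f @` A ** f @` B) (f x))).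
  - by rewrite rmorph0; exact: ideal_mul0.
  - by move=> x y; rewrite rmorphD; exact: ideal_mulD.
  - by move=> a b Aa Bb; rewrite rmorphM; apply: ideal_mul_in; [exists a|exists b].
apply: ideal_mul_ind.
- by exists 0; [exact: ideal_mul0|exact: rmorph0].
- move=> _ _ [x ABx <-] [y ABy <-]; exists (x + y); last exact: rmorphD.
  exact: ideal_mulD.
- move=> _ _ [a Aa <-] [b Bb <-]; exists (a * b); last exact: rmorphM.
  exact: ideal_mul_in.
Qed.

Lemma image_ideal_inv A : f @` ideal_inv A = ideal_inv (f @` A).
Proof.
apply/seteqP; split=> [_ [x Ax <-] _ [a Aa <-]|y Ay].
  by rewrite -rmorphM; apply: OK_rmorph; exact: Ax.
exists (g y); last exact: gK.
by move=> a Aa; rewrite -[a]fK -rmorphM; apply: OK_rmorph; apply: Ay; exists a.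
Qed.

Lemma image_ideal_exp A k : f @` ideal_exp A k = ideal_exp (f @` A) k.
Proof.
have iterE B m : f @` iter m (ideal_mul B) OK = iter m (ideal_mul (f @` B)) OK.
  by elim: m => [|m IH] /=; rewrite ?image_OK // image_ideal_mul IH.
by case: k => k; rewrite [LHS]iterE ?image_ideal_inv.
Qed.

Lemma image_nonzero_prime P : nonzero_prime P -> nonzero_prime (f @` P).
Proof.
move=> [[[P0 PD PM] PO nP1 Pmul] [a Pa a0]]; split; last first.
  by exists (f a); [exists a|rewrite fmorph_eq0].
split.
- split; first by exists 0; rewrite ?rmorph0.
    move=> _ _ [x Px <-] [y Py <-]; exists (x + y); [exact: PD|exact: rmorphD].
  move=> b _ Ob [x Px <-]; exists (g b * x); last by rewrite rmorphM gK.
  by apply: PM => //; exact: OK_rmorph.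
- by move=> _ [x /PO Ox <-]; exact: OK_rmorph.
- move=> [x Px fx1]; apply: nP1.
  by rewrite -(rmorph1 g) -fx1 fK.
- move=> x y Ox Oy [z Pz zE].
  have /Pmul[||?|?] : P (g x * g y) by rewrite -rmorphM -zE fK.
  + exact: OK_rmorph.
  + exact: OK_rmorph.
  + by left; exists (g x).
  + by right; exists (g y).
Qed.

End Transport.

Lemma image_prime_factorization (K : fieldExtType rat) (f g : {rmorphism K -> K})
    I (e : set K -> int) : cancel f g -> cancel g f ->
  prime_factorization I e ->
  prime_factorization (f @` I) (fun P => e (g @` P)).
Proof.
move=> fK gK [s [us sP e0 ->]].
exists [seq f @` P | P <- s]; split.
- by rewrite map_inj_uniq //; apply: (@can_inj _ _ _ (fun A => g @` A)); exact: image_cancel fK.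
- by move=> _ /mapP[P /sP pP ->]; exact: image_nonzero_prime.
- move=> P nP; apply: e0; apply: contra nP => gPs.
  by rewrite -(image_cancel gK P); exact: map_f.
- rewrite big_map (big_morph (fun A => f @` A) (image_ideal_mul f) (image_OK gK)).
  by apply: eq_bigr => P _; rewrite (image_cancel fK) (image_ideal_exp fK gK).
Qed.

Section Minkowski.
Variables (R : realType) (K : splittingFieldType rat) (iota : {rmorphism K -> R[i]}).
Variables (n : nat) (theta : gal_of {:K}).
Hypotheses (n_gt0 : (0 < n)%N) (theta_n : (theta ^+ n = 1)%g).

Lemma shift_minkowski x :
  shift (minkowski iota n theta x) = minkowski iota n theta (theta x).
Proof.
apply/rowP => j; rewrite !mxE -galM ?memvf // -expgS; congr (iota _).
case: j => [[|j] lt_j] /=.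
- rewrite subn0 add0n modn_small ?prednK // expgS theta_n mulg1.
  by rewrite -subn1 subKn // expg1.
by rewrite modnDr (modn_small (ltnW lt_j)) subnSK // ltnW.
Qed.

Lemma minkowski_inj : injective (minkowski iota n theta).
Proof.
case: n n_gt0 => // m _ x y /rowP/(_ ord0); rewrite !mxE.
by move=> /fmorph_inj /fmorph_inj.
Qed.

Lemma cyclic_minkowski (I : set K) :
  cyclic_lattice [set minkowski iota n theta x | x in I] <-> theta @` I = I.
Proof.
rewrite /cyclic_lattice.
have -> : [set shift c | c in [set minkowski iota n theta x | x in I]] =
          [set minkowski iota n theta x | x in theta @` I].
  rewrite !image_comp; apply: eq_imagel => x _; exact: shift_minkowski.
split=> [E|->//]; apply/funext => x.
by rewrite -[LHS](image_inj minkowski_inj) E (image_inj minkowski_inj).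
Qed.

End Minkowski.

Section GaloisAction.
Variable K : splittingFieldType rat.

Lemma gal_mulgV (tau : gal_of {:K}) : cancel tau (tau^-1)%g.
Proof. by move=> x; rewrite -galM ?memvf // mulgV gal_id. Qed.

Lemma gal_mulVg (tau : gal_of {:K}) : cancel (tau^-1)%g tau.
Proof. by move=> x; rewrite -galM ?memvf // mulVg gal_id. Qed.

Lemma image_gal_expg (theta : gal_of {:K}) (I : set K) k :
  theta @` I = I -> (theta ^+ k)%g @` I = I.
Proof.
move=> thI; elim: k => [|k IH].
  by rewrite expg0 -[RHS]image_id; apply: eq_imagel => x _; rewrite gal_id.
rewrite -[RHS]IH -[in RHS]thI image_comp; apply: eq_imagel => x _.
by rewrite expgS galM ?memvf.
Qed.

End GaloisAction.

Theorem theorem4 (R : realType) (K : splittingFieldType rat)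
    (iota : {rmorphism K -> R[i]}) (n : nat) (theta : gal_of {:K})
    (I : set K)
    (K_cyclic : cyclic_number_field K)
    (K_degree : \dim {:K} = n)
    (theta_gen : generator 'Gal({:K} / 1)%g theta)
    (I_ideal : fractional_ideal I)
    (I_nonzero : nonzero_ideal I) :
  cyclic_lattice [set minkowski iota n theta x | x in I] <->
  (forall P Q : set K,
     prime_ideal P -> nonzero_ideal P ->
     prime_ideal Q -> nonzero_ideal Q ->
     conjugate_ideals P Q -> ideal_valuation I P = ideal_valuation I Q).
Proof.
have [K_galois _] := K_cyclic.
have OK_res := finite_residues K_galois.
have Gal_theta : 'Gal({:K} / 1)%g = <[theta]>%g by exact/eqP.
have order_theta : #[theta]%g = n.
  by rewrite /order -Gal_theta -galois_dim // dimv1 divn1.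
have n_gt0 : (0 < n)%N by rewrite -order_theta order_gt0.
have theta_n : (theta ^+ n = 1)%g by rewrite -order_theta expg_order.
rewrite cyclic_minkowski //.
have [e eI] := fractional_ideal_factorization OK_res I_ideal I_nonzero.
rewrite (ideal_valuationE OK_res eI); split.
  move=> thI P _ _ _ _ _ [tau tauG <-].
  have tauI : tau @` I = I.
    by move: tauG; rewrite Gal_theta => /cycleP[k ->]; exact: image_gal_expg.
  have := image_prime_factorization (gal_mulgV tau) (gal_mulVg tau) eI.
  rewrite tauI => /(prime_factorization_unique OK_res eI) eE.
  by rewrite [in RHS]eE (image_cancel (gal_mulgV tau)).
move=> eP; apply: (@prime_factorization_inj _ _ _ e) => //.
have := image_prime_factorization (gal_mulgV theta) (gal_mulVg theta) eI.
congr (prime_factorization _ _); apply/funext => P.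
have [pP|npP] := pselect (nonzero_prime P).
  have [ptP ntP] := image_nonzero_prime (gal_mulVg theta) (gal_mulgV theta) pP.
  case: (pP) => P_prime P_nz; apply: eP => //; exists theta.
    by rewrite Gal_theta cycle_id.
  exact: image_cancel (gal_mulVg theta) P.
case: eI => s [_ sP e0 _]; have -> : e P = 0 by apply: e0; apply/negP => /sP.
apply: e0; apply/negP => /sP ptP; apply: npP; rewrite -(image_cancel (gal_mulVg theta) P).
exact: image_nonzero_prime (gal_mulgV theta) (gal_mulVg theta) _ ptP.
Qed.
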